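(* Let $y=\tan x$, $z=\sec x$ on $(-\pi/2,\pi/2)$, let $D=d/dx$, and define $(Dz)^0(f)=f$, $(Dz)^{n+1}(f)=D\big(z\,(Dz)^n(f)\big)$. Define polynomials $R_n(y)$, $T_n(y)$ ($n\ge1$) by, for $m\ge 0$, $$(Dz)^{2m}(z)=(2m)!\,z\,R_{2m+1}(y),\qquad (Dz)^{2m+1}(z)=(2m+1)!\,R_{2m+2}(y),$$ $$(Dz)^{2m}(y)=(2m)!\,T_{2m+1}(y),\qquad (Dz)^{2m+1}(y)=(2m+1)!\,z\,T_{2m+2}(y),$$ (using $z^2=1+y^2$). Then for $n\ge 1$, $$R_n(y)=\sum_{k=0}^{\lfloor (n-1)/2\rfloor}\binom{n}{2k+1}\,y^{n-2k-1}(1+y^2)^{\lfloor n/2\rfloor+k}$$ and $$T_n(y)=\sum_{k=0}^{\lfloor n/2\rfloor}\binom{n}{2k}\,y^{n-2k}(1+y^2)^{\lfloor (n-1)/2\rfloor+k}.$$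
   Context: $R_n$ and $T_n$ are polynomials in $y$ with real coefficients, uniquely determined by the displayed identities holding for all $x\in(-\pi/2,\pi/2)$, since $\tan x$ takes infinitely many values there. *)

(* Defs.v *)
From HB Require Import structures.
From mathcomp Require Import all_boot all_order all_algebra.
From mathcomp Require Import all_classical all_reals all_analysis.
Import Order.TTheory GRing.Theory Num.Theory.
Import numFieldNormedType.Exports.

Set Implicit Arguments.
Unset Strict Implicit.
Unset Printing Implicit Defensive.

Local Open Scope ring_scope.

Definition sec (K : realType) (x : K) : K := (cos x)^-1.

(* Functions are total on K, but only their values on ]-pi/2, pi/2[ are used;
   this interval is open and [derive1] is local, so the values of [tan], [sec]
   and their derivatives elsewhere do not matter. *)
Definition Dz (K : realType) (f : K -> K) : K -> K :=
  derive1 (fun x => sec x * f x).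

(* The identities defining R_n for n >= 1; the value at index 0 is
   unconstrained. *)
Definition sec_polys (K : realType) (R : nat -> {poly K}) : Prop :=
  forall (m : nat) (x : K), - (pi / 2) < x < pi / 2 ->
    iter (2 * m) (@Dz K) (@sec K) x
      = ((2 * m)`!)%:R * sec x * (R (2 * m + 1)%N).[tan x]
    /\
    iter (2 * m + 1) (@Dz K) (@sec K) x
      = ((2 * m + 1)`!)%:R * (R (2 * m + 2)%N).[tan x].

(* Likewise for T_n, n >= 1. *)
Definition tan_polys (K : realType) (T : nat -> {poly K}) : Prop :=
  forall (m : nat) (x : K), - (pi / 2) < x < pi / 2 ->
    iter (2 * m) (@Dz K) (@tan K) x
      = ((2 * m)`!)%:R * (T (2 * m + 1)%N).[tan x]
    /\
    iter (2 * m + 1) (@Dz K) (@tan K) x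
      = ((2 * m + 1)`!)%:R * sec x * (T (2 * m + 2)%N).[tan x].

(* Main.v *)
(* Put u = tan + sec and v = tan - sec.  The logarithmic derivatives of sec * u
   and sec * v are u and v, whence
   (Dz)^n (a u + b v) = n! sec^n (a u^(n+1) + b v^(n+1)).  Taking (a, b) =
   (1/2, -1/2) and (1/2, 1/2) gives (Dz)^n applied to sec and tan; the odd and
   even parts of the binomial expansions of u^(n+1) and v^(n+1) are the claimed
   sums. *)
Require Import Defs.
From HB Require Import structures.
From mathcomp Require Import all_boot all_order all_algebra.
From mathcomp Require Import all_classical all_reals all_analysis.
From mathcomp Require Import zify ring.
Import Order.TTheory GRing.Theory Num.Theory.
Import numFieldNormedType.Exports.

Local Open Scope ring_scope.

(** * Binomial expansion split by parity *)

Lemma exprDn_pad (A : comNzRingType) (y z : A) (n M : nat) : (n < M)%N ->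
  (y + z) ^+ n = \sum_(0 <= i < M) 'C(n, i)%:R * (y ^+ (n - i) * z ^+ i).
Proof.
move=> nM; rewrite exprDn.
rewrite [RHS](@big_cat_nat _ _ _ n.+1) //= -[LHS]addr0 big_mkord; congr (_ + _).
  by apply: eq_bigr => i _; rewrite mulr_natl.
rewrite big_nat_cond big1 // => i /andP[/andP[ni _] _].
by rewrite bin_small ?mul0r.
Qed.

Lemma big_nat_double (A : nmodType) (F : nat -> A) (N : nat) :
  \sum_(0 <= i < 2 * N) F i
    = \sum_(0 <= k < N) F (2 * k)%N + \sum_(0 <= k < N) F (2 * k + 1)%N.
Proof.
elim: N => [|N IH]; first by rewrite muln0 !big_nil addr0.
rewrite (_ : 2 * N.+1 = (2 * N).+2)%N; last by lia.
by rewrite !big_nat_recr //= IH addn1 addrACA addrA.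
Qed.

(** Padding the expansion with vanishing binomials up to an even length pairs the indices [2 * k]
    and [2 * k + 1]. *)
Lemma exprD_parity (A : comNzRingType) (y z : A) (n : nat) :
  (y + z) ^+ n
    = \sum_(0 <= k < (n %/ 2).+1) 'C(n, 2 * k)%:R * (y ^+ (n - 2 * k) * z ^+ (2 * k))
    + \sum_(0 <= k < ((n - 1) %/ 2).+1)
        'C(n, 2 * k + 1)%:R * (y ^+ (n - 2 * k - 1) * z ^+ (2 * k + 1)).
Proof.
rewrite (@exprDn_pad _ _ _ _ (2 * (n %/ 2).+1)); last by lia.
rewrite big_nat_double; congr (_ + _).
(* For even positive [n] the padded odd sum has one extra index, where the binomial is
   ['C(n, n + 1)], which is 0. *)
rewrite (@big_cat_nat _ _ _ ((n - 1) %/ 2).+1) //=; last by lia.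
rewrite -[RHS]addr0; congr (_ + _); first by apply: eq_bigr => k _; rewrite subnDA.
rewrite big_nat_cond big1 // => k /andP[/andP[nk _] _].
by rewrite bin_small ?mul0r //; lia.
Qed.

(** * The closed forms in terms of powers of [y + z] and [y - z] *)

Definition sec_poly (K : fieldType) (n : nat) : {poly K} :=
  \sum_(0 <= k < ((n - 1) %/ 2).+1)
    ('C(n, 2 * k + 1))%:R *:
      ('X ^+ (n - 2 * k - 1) * (1 + 'X ^+ 2) ^+ (n %/ 2 + k)).

Definition tan_poly (K : fieldType) (n : nat) : {poly K} :=
  \sum_(0 <= k < (n %/ 2).+1)
    ('C(n, 2 * k))%:R *:
      ('X ^+ (n - 2 * k) * (1 + 'X ^+ 2) ^+ ((n - 1) %/ 2 + k)).

(** Even powers of [z] cancel in the difference and odd ones double; each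
    [z * (1 + y ^+ 2) ^+ (n %/ 2 + k)] is [z ^+ (2 * (n %/ 2))] times [z ^+ (2 * k + 1)]. *)
Lemma sec_polyE (K : fieldType) (y z : K) (n : nat) : 1 + y ^+ 2 = z ^+ 2 ->
  2 * (z * (sec_poly K n).[y])
    = z ^+ (2 * (n %/ 2)) * ((y + z) ^+ n - (y - z) ^+ n).
Proof.
move=> yz; rewrite !exprD_parity.
under [X in _ - (X + _)]eq_bigr do rewrite exprM sqrrN -exprM.
under [X in _ - (_ + X)]eq_bigr do
  rewrite addn1 exprS mulNr exprM sqrrN -exprM -exprS -addn1 !mulrN.
rewrite sumrN opprD opprK addrACA subrr add0r -mulr2n mulrnAr -[RHS]mulr_natl.
congr (_ * _).
rewrite horner_sum !mulr_sumr; apply: eq_bigr => k _.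
rewrite hornerZ hornerM !horner_exp hornerD hornerC horner_exp hornerX yz -exprM.
move: (y ^+ _) ('C(_, _)%:R) (_ %/ 2)%N => a c m.
rewrite mulnDr !exprD; ring.
Qed.

Lemma tan_polyE (K : fieldType) (y z : K) (n : nat) : 1 + y ^+ 2 = z ^+ 2 ->
  2 * (tan_poly K n).[y]
    = z ^+ (2 * ((n - 1) %/ 2)) * ((y + z) ^+ n + (y - z) ^+ n).
Proof.
move=> yz; rewrite !exprD_parity.
under [X in _ + (X + _)]eq_bigr do rewrite exprM sqrrN -exprM.
under [X in _ + (_ + X)]eq_bigr do
  rewrite addn1 exprS mulNr exprM sqrrN -exprM -exprS -addn1 !mulrN.
rewrite sumrN addrACA subrr addr0 -mulr2n mulrnAr -[RHS]mulr_natl.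
congr (_ * _).
rewrite horner_sum !mulr_sumr; apply: eq_bigr => k _.
rewrite hornerZ hornerM !horner_exp hornerD hornerC horner_exp hornerX yz -exprM.
move: (y ^+ _) ('C(_, _)%:R) (_ %/ 2)%N => a c m.
rewrite mulnDr !exprD; ring.
Qed.

Lemma poly_eq_horner (K : numDomainType) (p q : {poly K}) :
  (forall y, p.[y] = q.[y]) -> p = q.
Proof.
move=> pq; apply/eqP; rewrite -subr_eq0; apply/eqP.
(* The naturals below the size of [p - q] are distinct roots of it, too many for a nonzero
   polynomial. *)
apply: (@roots_geq_poly_eq0 _ _ [seq i%:R | i <- iota 0 (size (p - q))]).
- by apply/allP => y _; rewrite /root !hornerE pq subrr.
- by rewrite map_inj_uniq ?iota_uniq // => i j /eqP; rewrite eqr_nat => /eqP.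
- by rewrite size_map size_iota.
Qed.

(** * Iterates of [Dz] on the interval *)

Section Derivatives.
Variable K : realType.
Implicit Types x s a b : K.

Lemma sec_gt0 x : - (pi / 2) < x < pi / 2 -> 0 < sec x.
Proof. by move=> hx; rewrite /sec invr_gt0 cos_gt0_pihalf. Qed.

Lemma sec2_tan2 x : - (pi / 2) < x < pi / 2 -> 1 + tan x ^+ 2 = sec x ^+ 2.
Proof. by move=> hx; rewrite -cos2_tan2 ?exprVn // gt_eqF ?cos_gt0_pihalf. Qed.

Lemma is_derive_sec x : - (pi / 2) < x < pi / 2 ->
  is_derive x 1 (@sec K) (sec x * tan x).
Proof.
move=> hx; have c0 : cos x != 0 by rewrite gt_eqF ?cos_gt0_pihalf.
apply: is_derive_eq; first exact: is_deriveV.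
by rewrite /sec /tan /GRing.scale /=; field.
Qed.

(* For [u = tan + s sec] with [s = 1] or [-1], the logarithmic derivative of
   [sec * u] is [tan + s sec = u] itself. *)
Lemma is_derive_sec_tan_exp x s n : s ^+ 2 = 1 -> - (pi / 2) < x < pi / 2 ->
  is_derive x 1 (fun t => (sec t * (tan t + s * sec t)) ^+ n.+1)
    (n.+1%:R * sec x ^+ n.+1 * (tan x + s * sec x) ^+ n.+2).
Proof.
move=> s2 hx; have c0 : cos x != 0 by rewrite gt_eqF ?cos_gt0_pihalf.
have ds := is_derive_sec _ hx; have dt := is_derive_tan c0.
rewrite (_ : (fun t => _) = (@sec K * (@tan K + s *: @sec K)) ^+ n.+1); last first.
  by apply/funext => t; rewrite fctE.
apply: is_derive_eq.
rewrite /= /GRing.scale /= !fctE cos2_tan2 // sec2_tan2 //.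
rewrite -[s \*: _]/(fun t => s * sec t).
move: (sec x) (tan x) => z y.
(* Writing [z ^+ 2] as [(s * z) ^+ 2] makes the derivative of the base,
   [z * (y ^+ 2 + 2 * s * y * z + z ^+ 2)], equal to [z * (y + s * z) ^+ 2]. *)
rewrite -[z ^+ 2]mul1r -s2 exprMn !exprS; ring.
Qed.

Lemma iter_Dz (a b : K) n x : - (pi / 2) < x < pi / 2 ->
  iter n (@Dz K) (fun t => a * (tan t + sec t) + b * (tan t - sec t)) x
  = n`!%:R * sec x ^+ n *
      (a * (tan x + sec x) ^+ n.+1 + b * (tan x - sec x) ^+ n.+1).
Proof.
elim: n x => [|n IH] x hx /=; first by rewrite !mul1r !expr1.
rewrite /Dz derive1E.
pose g s t : K := (sec t * (tan t + s * sec t)) ^+ n.+1.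
(* The induction hypothesis holds only on the open interval, which suffices because the derivative
   is local. The extra factor [sec] from [Dz] completes each term to a power of [sec * u] or
   [sec * v]. *)
rewrite (@near_eq_derive _ _ _ _ (n`!%:R *: (a *: g 1 + b *: g (-1)))); last first.
  have hx' : x \in `]- (pi / 2), pi / 2[ by rewrite in_itv.
  near=> t; rewrite IH; last first.
    suff : t \in `]- (pi / 2), pi / 2[ by rewrite in_itv.
    by near: t; exact: near_in_itvoo.
  rewrite -[RHS]/(n`!%:R * (a * g 1 t + b * g (-1) t)).
  rewrite /g mul1r mulN1r !exprMn (exprS (sec t) n); ring.
have d1 := is_derive_sec_tan_exp x 1 n (expr1n _ _) hx.
have d2 := is_derive_sec_tan_exp x (-1) n (sqrr_sign _ 1) hx.
rewrite derive_val /GRing.scale /= mul1r mulN1r factS natrM; ring.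
Unshelve. all: by end_near. Qed.

Lemma iter_Dz_sec n x : - (pi / 2) < x < pi / 2 ->
  2 * iter n (@Dz K) (@sec K) x
  = n`!%:R * sec x ^+ n *
      ((tan x + sec x) ^+ n.+1 - (tan x - sec x) ^+ n.+1).
Proof.
move=> hx; rewrite [X in iter _ _ X](_ : _ =
  fun t => 2^-1 * (tan t + sec t) + - 2^-1 * (tan t - sec t)); last first.
  by apply/funext => t; field.
by rewrite iter_Dz //; field.
Qed.

Lemma iter_Dz_tan n x : - (pi / 2) < x < pi / 2 ->
  2 * iter n (@Dz K) (@tan K) x
  = n`!%:R * sec x ^+ n *
      ((tan x + sec x) ^+ n.+1 + (tan x - sec x) ^+ n.+1).
Proof.
move=> hx; rewrite [X in iter _ _ X](_ : _ =
  fun t => 2^-1 * (tan t + sec t) + 2^-1 * (tan t - sec t)); last first.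
  by apply/funext => t; field.
by rewrite iter_Dz //; field.
Qed.

(** * Existence and uniqueness of the polynomials *)

Lemma sec_polys_sec_poly : sec_polys (sec_poly K).
Proof.
move=> m x hx; have z0 : sec x != 0 by rewrite gt_eqF ?sec_gt0.
have yz := sec2_tan2 _ hx; have two0 : (2 : K) != 0 by rewrite pnatr_eq0.
split.
  have := sec_polyE _ _ _ (2 * m + 1) yz.
  rewrite (_ : (2 * m + 1) %/ 2 = m)%N => [e|]; last by lia.
  apply: (mulfI two0); rewrite iter_Dz_sec // -[(2 * m).+1]addn1 -!mulrA -e; ring.
have := sec_polyE _ _ _ (2 * m + 2) yz.
rewrite (_ : 2 * ((2 * m + 2) %/ 2) = (2 * m + 1).+1)%N => [|]; last by lia.
(* At even index the right side of [sec_polyE] carries one more [sec] than the iterate; it cancels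
   against the [sec] on the left. *)
rewrite exprS -mulrA mulrCA => /(mulfI z0) e.
apply: (mulfI two0); rewrite iter_Dz_sec // -[(2 * m + 1).+1]addnS -mulrA -e; ring.
Qed.

Lemma tan_polys_tan_poly : tan_polys (tan_poly K).
Proof.
move=> m x hx; have yz := sec2_tan2 _ hx.
have two0 : (2 : K) != 0 by rewrite pnatr_eq0.
split; apply: (mulfI two0); rewrite iter_Dz_tan //.
  have := tan_polyE _ _ _ (2 * m + 1) yz.
  rewrite (_ : (2 * m + 1 - 1) %/ 2 = m)%N => [e|]; last by lia.
  rewrite -[(2 * m).+1]addn1 -mulrA -e; ring.
have := tan_polyE _ _ _ (2 * m + 2) yz.
rewrite (_ : (2 * m + 2 - 1) %/ 2 = m)%N => [e|]; last by lia.
(* Here [tan_polyE] supplies only [sec x ^+ (2 * m)]; the remaining [sec] of the iterate is the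
   explicit factor in [tan_polys]. *)
rewrite -[(2 * m + 1).+1]addnS [in sec x ^+ _]addn1 exprS -!mulrA -e; ring.
Qed.

(** [tan] maps the interval onto all of [K], with [atan] giving preimages. *)
Lemma poly_eq_tan (p q : {poly K}) :
  (forall x, - (pi / 2) < x < pi / 2 -> p.[tan x] = q.[tan x]) -> p = q.
Proof.
move=> pq; apply: poly_eq_horner => y.
by rewrite -(atanK y) pq // atan_gtNpi2 atan_ltpi2.
Qed.

(** The factorial and [sec x] are nonzero, so each defining identity determines the value of the
    polynomial at [tan x]. *)
Lemma sec_polys_uniq (P Q : nat -> {poly K}) :
  sec_polys P -> sec_polys Q -> forall n, (1 <= n)%N -> P n = Q n.
Proof.
move=> hP hQ n n1; apply: poly_eq_tan => x hx.
have z0 : sec x != 0 by rewrite gt_eqF ?sec_gt0.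
have f0 k : k`!%:R != 0 :> K by rewrite pnatr_eq0 -lt0n fact_gt0.
have [m n12] : exists m, (n = 2 * m + 1 \/ n = 2 * m + 2)%N.
  by exists ((n - 1) %/ 2)%N; lia.
have [P1 P2] := hP m x hx; have [Q1 Q2] := hQ m x hx.
case: n12 => ->.
- by apply: (mulfI (mulf_neq0 (f0 (2 * m)%N) z0)); rewrite -P1 -Q1.
- by apply: (mulfI (f0 (2 * m + 1)%N)); rewrite -P2 -Q2.
Qed.

Lemma tan_polys_uniq (P Q : nat -> {poly K}) :
  tan_polys P -> tan_polys Q -> forall n, (1 <= n)%N -> P n = Q n.
Proof.
move=> hP hQ n n1; apply: poly_eq_tan => x hx.
have z0 : sec x != 0 by rewrite gt_eqF ?sec_gt0.
have f0 k : k`!%:R != 0 :> K by rewrite pnatr_eq0 -lt0n fact_gt0.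
have [m n12] : exists m, (n = 2 * m + 1 \/ n = 2 * m + 2)%N.
  by exists ((n - 1) %/ 2)%N; lia.
have [P1 P2] := hP m x hx; have [Q1 Q2] := hQ m x hx.
case: n12 => ->.
- by apply: (mulfI (f0 (2 * m)%N)); rewrite -P1 -Q1.
- by apply: (mulfI (mulf_neq0 (f0 (2 * m + 1)%N) z0)); rewrite -P2 -Q2.
Qed.

End Derivatives.

Theorem theorem2 (K : realType) :
  (exists R : nat -> {poly K}, sec_polys R) /\
  (exists T : nat -> {poly K}, tan_polys T) /\
  (forall R : nat -> {poly K}, sec_polys R ->
     forall n : nat, (1 <= n)%N ->
       R n = \sum_(0 <= k < ((n - 1) %/ 2).+1)
               ('C(n, 2 * k + 1))%:R *:
                 ('X ^+ (n - 2 * k - 1) * (1 + 'X ^+ 2) ^+ (n %/ 2 + k))) /\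
  (forall T : nat -> {poly K}, tan_polys T ->
     forall n : nat, (1 <= n)%N ->
       T n = \sum_(0 <= k < (n %/ 2).+1)
               ('C(n, 2 * k))%:R *:
                 ('X ^+ (n - 2 * k) * (1 + 'X ^+ 2) ^+ ((n - 1) %/ 2 + k))).
Proof.
split; first by exists (sec_poly K); exact: sec_polys_sec_poly.
split; first by exists (tan_poly K); exact: tan_polys_tan_poly.
split=> P hP n n1.
- exact: sec_polys_uniq hP (sec_polys_sec_poly K) _ n1.
- exact: tan_polys_uniq hP (tan_polys_tan_poly K) _ n1.
Qed.
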